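(* The system $z_3'=z_2$, $z_2'=z_1$, $z_1'=-i\,z_3/|z_3|$ on $\mathbb{C}^3$ admits, for $t>0$, the outward-moving logarithmic spiral solution $$z_3^*(t)=\tfrac1{10}t^{3-i},\qquad z_2^*(t)=\tfrac{3-i}{10}t^{2-i},\qquad z_1^*(t)=\tfrac{(2-i)(3-i)}{10}t^{1-i},$$ and, for every $T>0$, the inward-moving logarithmic spiral solution $z_3(t)=\overline{z_3^*(T-t)}$, $z_2(t)=-\overline{z_2^*(T-t)}$, $z_1(t)=\overline{z_1^*(T-t)}$ for $t<T$, which reaches $(0,0,0)$ at time $T$. Moreover $\mathcal{H}_c(z_3^*,z_2^*,z_1^* )=\mathcal{A}_c(z_3^*,z_2^*,z_1^* )=0$, and the control $u(t)=\beta_1z_3(t)/|z_3(t)|$ associated with the inward spiral performs infinitely many rotations along a circle in the finite time $T$: any continuous argument of $z_3(t)/|z_3(t)|$ is unbounded as $t\to T^-$.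
   Context: For $t>0$ and $k=1,2,3$, $t^{k-i}=t^ke^{-i\ln t}$. Here $$\mathcal{H}_c=\frac i2(z_2\bar z_1-\bar z_2z_1)+|z_3|,\qquad\mathcal{A}_c=|z_2|^2-(z_1\bar z_3+\bar z_1z_3),$$ and $\beta_1>0$ is a constant (the radius parameter $\beta/\alpha$ of the disk control set). *)

(* Defs.v *)
From Stdlib Require Export Reals.
From Coquelicot Require Export Coquelicot.

Open Scope R_scope.
Open Scope C_scope.

(* Coquelicot has no complex exponential. *)
Definition Cexp (z : C) : C :=
  RtoC (exp (Re z)) * (cos (Im z), sin (Im z))%R.

(* [tpow k t] is t^(k-i) = t^k e^(-i ln t); meaningful for t > 0 only. *)
Definition tpow (k : nat) (t : R) : C :=
  RtoC (t ^ k)%R * Cexp (- Ci * RtoC (ln t)).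

(* Curves R -> C are differentiated with C seen as a real normed space. *)
Definition has_derivative (f : R -> C) (t : R) (l : C) : Prop :=
  @is_derive R_AbsRing C_R_NormedModule f t l.

Definition direction (z : R -> C) (t : R) : C := z t / RtoC (Cmod (z t)).

(* Since division in C is total, z3 t <> 0 is required explicitly: this is
   where the right-hand side z3/|z3| is defined. *)
Definition is_solution (I : R -> Prop) (z3 z2 z1 : R -> C) : Prop :=
  forall t : R, I t ->
    z3 t <> RtoC 0 /\
    has_derivative z3 t (z2 t) /\
    has_derivative z2 t (z1 t) /\
    has_derivative z1 t (- Ci * direction z3 t).

(* The trace of z over I is a full logarithmic spiral
   { c e^((b+i) theta) : theta real } around the origin, c <> 0, b <> 0. *)
Definition traces_log_spiral (I : R -> Prop) (z : R -> C) : Prop :=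
  exists (c : C) (b : R), c <> RtoC 0 /\ b <> 0%R /\
    forall w : C,
      (exists t : R, I t /\ z t = w) <->
      (exists theta : R, w = c * Cexp ((RtoC b + Ci) * RtoC theta)).

Definition outward_log_spiral (I : R -> Prop) (z : R -> C) : Prop :=
  traces_log_spiral I z /\
  forall s t : R, I s -> I t -> (s < t)%R -> (Cmod (z s) < Cmod (z t))%R.

Definition inward_log_spiral (I : R -> Prop) (z : R -> C) : Prop :=
  traces_log_spiral I z /\
  forall s t : R, I s -> I t -> (s < t)%R -> (Cmod (z t) < Cmod (z s))%R.

Definition z3star (t : R) : C := RtoC (1 / 10)%R * tpow 3 t.

Definition z2star (t : R) : C := (RtoC 3 - Ci) / RtoC 10 * tpow 2 t.

Definition z1star (t : R) : C :=
  (RtoC 2 - Ci) * (RtoC 3 - Ci) / RtoC 10 * tpow 1 t.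

Definition z3in (T t : R) : C := Cconj (z3star (T - t)).

Definition z2in (T t : R) : C := - Cconj (z2star (T - t)).

Definition z1in (T t : R) : C := Cconj (z1star (T - t)).

Definition Hc (z3 z2 z1 : C) : C :=
  Ci / RtoC 2 * (z2 * Cconj z1 - Cconj z2 * z1) + RtoC (Cmod z3).

Definition Ac (z3 z2 z1 : C) : C :=
  RtoC (Cmod z2 ^ 2)%R - (z1 * Cconj z3 + Cconj z1 * z3).

Definition control (beta1 : R) (z3 : R -> C) (t : R) : C :=
  RtoC beta1 * z3 t / RtoC (Cmod (z3 t)).

Definition continuous_argument (I : R -> Prop) (f : R -> C) (theta : R -> R)
  : Prop :=
  forall t : R, I t ->
    continuous theta t /\
    f t = RtoC (Cmod (f t)) * Cexp (Ci * RtoC (theta t)).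

(* Every continuous argument of f on some interval (t0, T) is unbounded on
   each left neighbourhood of T. *)
Definition infinitely_many_rotations (f : R -> C) (T : R) : Prop :=
  forall (t0 : R) (theta : R -> R),
    (t0 < T)%R ->
    continuous_argument (fun t => (t0 < t < T)%R) f theta ->
    forall M delta : R, (0 < delta)%R ->
      exists t : R,
        (t0 < t < T)%R /\ (T - delta < t)%R /\ (M < Rabs (theta t))%R.

(* Main.v *)
Require Import Defs.
From Stdlib Require Import Reals Lra.
From Coquelicot Require Import Coquelicot.

Local Open Scope C_scope.

(** Differentiating [t^(k-i)] multiplies it by [k-i] and lowers [k] by one
    ([has_derivative_tpow]), so three derivatives of [t^(3-i)/10] give
    [(3-i)(2-i)(1-i)/10 t^(-i)]. Since [(3-i)(2-i)(1-i) = -10i], this is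
    [-i t^(-i)], and [t^(-i)] is exactly the direction of [t^(3-i)/10]; the
    factor [1/10] normalises the product. Hence the outward spiral is a solution.
    The system is invariant under [t -> T-t] combined with
    [(z3, z2, z1) -> (conj z3, - conj z2, conj z1)], which turns the outward
    solution into the inward one ([solution_reverse]).

    Every component is [c e^((k-i) s)] in the time [s = ln t], or
    [c e^((k+i) s)] with [s = ln (T-t)] after reversal. As [s] sweeps the whole
    line, the trace is a full logarithmic spiral, and its modulus [|c| t^k] or
    [|c| (T-t)^k] is strictly monotone and vanishes with [t] or [T-t]. In
    [Hc] and [Ac] the phases cancel, since every product pairs a component
    with a conjugate; what remains is [Im (z2 conj z1) = t^3/10 = |z3|] and
    [|z2|^2 = t^4/10 = 2 Re (z1 conj z3)].

    The direction of the inward spiral is [e^(i ln (T-t))], so [ln (T-t)] is one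
    of its continuous arguments. Any other one differs from it by a constant
    ([continuous_argument_unique]), hence also tends to minus infinity at [T]. *)

(** * The complex exponential and the powers [t^(k-i)] *)

Lemma Cexp_plus (z w : C) : Cexp (z + w) = Cexp z * Cexp w.
Proof.
  unfold Cexp, Re, Im; destruct z as [a b], w as [c d]; simpl.
  rewrite exp_plus, cos_plus, sin_plus.
  apply injective_projections; simpl; ring.
Qed.

Lemma Cexp_conj (z : C) : Cconj (Cexp z) = Cexp (Cconj z).
Proof.
  unfold Cexp, Re, Im; destruct z as [a b]; simpl.
  rewrite cos_neg, sin_neg.
  apply injective_projections; simpl; ring.
Qed.

Lemma Cmod_Cexp (z : C) : Cmod (Cexp z) = exp (Re z).
Proof.
  unfold Cexp; rewrite Cmod_mult, Cmod_R.
  replace (Cmod (cos (Im z), sin (Im z))) with 1%R.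
  - rewrite Rabs_pos_eq; [ring | left; apply exp_pos].
  - unfold Cmod; simpl fst; simpl snd.
    rewrite <- sqrt_1; f_equal.
    generalize (sin2_cos2 (Im z)); unfold Rsqr; intros H.
    rewrite <- H; ring.
Qed.

Lemma tpow_Cexp (k : nat) (t : R) :
  (0 < t)%R -> tpow k t = Cexp ((RtoC (INR k) - Ci) * RtoC (ln t)).
Proof.
  intros Ht; unfold tpow.
  replace ((RtoC (INR k) - Ci) * RtoC (ln t))
    with (RtoC (INR k * ln t)%R + (- Ci * RtoC (ln t)))
    by (apply injective_projections; simpl; ring).
  rewrite Cexp_plus; f_equal.
  rewrite <- Rpower_pow by exact Ht.
  unfold Cexp, Rpower; simpl; rewrite cos_0, sin_0.
  apply injective_projections; simpl; ring.
Qed.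

(** Cartesian coordinates, in which derivatives and the values of [Hc] and [Ac]
    are real computations. *)
Lemma tpow_coord (k : nat) (t : R) :
  tpow k t = (t ^ k * cos (ln t), - (t ^ k * sin (ln t)))%R.
Proof.
  unfold tpow, Cexp.
  replace (- Ci * RtoC (ln t)) with ((0, - ln t)%R : C)
    by (apply injective_projections; simpl; ring).
  simpl; rewrite exp_0, cos_neg, sin_neg.
  apply injective_projections; simpl; ring.
Qed.

Lemma Cmod_tpow (k : nat) (t : R) : (0 < t)%R -> Cmod (tpow k t) = (t ^ k)%R.
Proof.
  intros Ht; unfold tpow; rewrite Cmod_mult, Cmod_R, Cmod_Cexp.
  replace (Re (- Ci * RtoC (ln t))) with 0%R by (simpl; ring).
  rewrite exp_0, Rabs_pos_eq; [ring | left; apply pow_lt, Ht].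
Qed.

Lemma tpow_neq_0 (k : nat) (t : R) : (0 < t)%R -> tpow k t <> RtoC 0.
Proof.
  intros Ht; apply Cmod_gt_0; rewrite Cmod_tpow by exact Ht.
  apply pow_lt, Ht.
Qed.

Lemma direction_scal_tpow (r : R) (k : nat) (t : R) (z : R -> C) :
  (0 < r)%R -> (0 < t)%R -> z t = RtoC r * tpow k t ->
  direction z t = tpow 0 t.
Proof.
  intros Hr Ht Hz; unfold direction; rewrite Hz.
  rewrite Cmod_mult, Cmod_R, Cmod_tpow, Rabs_pos_eq by lra.
  assert (Htk : (0 < t ^ k)%R) by (apply pow_lt, Ht).
  rewrite !tpow_coord; simpl pow.
  rewrite RtoC_mult.
  assert (RtoC r <> 0) by (intros E; apply RtoC_inj in E; lra).
  assert (RtoC (t ^ k) <> 0) by (intros E; apply RtoC_inj in E; lra).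
  replace ((t ^ k * cos (ln t), - (t ^ k * sin (ln t)))%R : C)
    with (RtoC (t ^ k) * ((1 * cos (ln t), - (1 * sin (ln t)))%R : C))
    by (apply injective_projections; simpl; ring).
  field; auto.
Qed.

Lemma direction_conj (z w : R -> C) (s t : R) :
  z t <> RtoC 0 -> w s = Cconj (z t) -> direction w s = Cconj (direction z t).
Proof.
  intros Hz E; unfold direction; rewrite E, Cmod_conj, Cdiv_conj.
  - f_equal; apply injective_projections; simpl; ring.
  - intros H; apply RtoC_inj in H; apply Hz, Cmod_eq_0, H.
Qed.

(** * Derivatives *)

(** Writing a pair as [a (1,0) + b (0,1)] reduces to derivatives of real
    multiples of a fixed vector. *)
Lemma has_derivative_pair (a b : R -> R) (t la lb : R) :
  is_derive a t la -> is_derive b t lb ->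
  has_derivative (fun s => (a s, b s)) t (la, lb).
Proof.
  intros Ha Hb.
  assert (E : forall x y : R, ((x, y) : C) =
      @plus C_R_NormedModule (@scal _ C_R_NormedModule x ((1, 0)%R : C))
        (@scal _ C_R_NormedModule y ((0, 1)%R : C))).
  { intros x y; apply injective_projections; simpl;
    unfold plus, scal; simpl; unfold mult; simpl; ring. }
  unfold has_derivative; rewrite E.
  apply is_derive_ext with (1 := fun s => eq_sym (E (a s) (b s))).
  apply @is_derive_plus; apply @is_derive_scal_l; assumption.
Qed.

(** Used for multiplication by a complex constant and for conjugation, which is
    only real-linear: this is why [C] is treated as a real normed space. *)
Lemma has_derivative_linear (L : C -> C) (f : R -> C) (t : R) (l : C) :
  @is_linear R_AbsRing C_R_NormedModule C_R_NormedModule L ->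
  has_derivative f t l -> has_derivative (fun s => L (f s)) t (L l).
Proof.
  intros HL Hf; unfold has_derivative, is_derive.
  apply filterdiff_ext_lin with (fun y : R => L (@scal _ C_R_NormedModule y l)).
  - apply (filterdiff_comp' (V := C_R_NormedModule) (W := C_R_NormedModule) f L).
    + exact Hf.
    + apply filterdiff_linear, HL.
  - intros y; apply (@linear_scal _ C_R_NormedModule C_R_NormedModule L HL).
Qed.

(** The product norm of [R * R] squares absolute values of coordinates where
    [Cmod] squares the coordinates, so the two are not convertible. *)
Lemma norm_C_R (z : C) : @norm R_AbsRing C_R_NormedModule z = Cmod z.
Proof.
  unfold norm; simpl; unfold prod_norm, norm; simpl; unfold abs, Cmod; simpl.
  f_equal; rewrite !Rmult_1_r, <- !Rabs_mult, !Rabs_pos_eq;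
    first [reflexivity | apply Rle_0_sqr].
Qed.

Lemma is_linear_Cmult (c : C) :
  @is_linear R_AbsRing C_R_NormedModule C_R_NormedModule (fun z => c * z).
Proof.
  split.
  - intros x y; apply injective_projections; simpl;
    unfold plus; simpl; ring.
  - intros k x; apply injective_projections; simpl;
    unfold scal; simpl; unfold mult; simpl; ring.
  - exists (Cmod c + 1)%R; split.
    + generalize (Cmod_ge_0 c); lra.
    + intros x; rewrite !norm_C_R, Cmod_mult;
      generalize (Cmod_ge_0 x); lra.
Qed.

Lemma is_linear_Cconj :
  @is_linear R_AbsRing C_R_NormedModule C_R_NormedModule Cconj.
Proof.
  split.
  - intros x y; apply injective_projections; simpl;
    unfold plus; simpl; ring.
  - intros k x; apply injective_projections; simpl;
    unfold scal; simpl; unfold mult; simpl; ring.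
  - exists 1%R; split; [lra |].
    intros x; rewrite !norm_C_R, Cmod_conj; lra.
Qed.

Lemma has_derivative_reverse (f : R -> C) (T t : R) (l : C) :
  has_derivative f (T - t) l -> has_derivative (fun s => f (T - s)%R) t (- l).
Proof.
  intros Hf.
  replace (- l) with (@scal _ C_R_NormedModule (-1)%R l).
  - apply (is_derive_comp (V := C_R_NormedModule) f (fun s => T - s)%R);
      [exact Hf |].
    auto_derive; [exact I | ring].
  - apply injective_projections; simpl; unfold scal; simpl;
    unfold mult; simpl; ring.
Qed.

Lemma has_derivative_tpow (c : C) (k : nat) (t : R) : (0 < t)%R ->
  has_derivative (fun s => c * tpow (S k) s) t
    (c * (RtoC (INR (S k)) - Ci) * tpow k t).
Proof.
  intros Ht; rewrite <- Cmult_assoc.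
  apply (has_derivative_linear (fun z => c * z)); [apply is_linear_Cmult |].
  unfold has_derivative.
  apply is_derive_ext with (1 := fun s => eq_sym (tpow_coord (S k) s)).
  replace ((RtoC (INR (S k)) - Ci) * tpow k t) with
    ((INR (S k) * t ^ k * cos (ln t) - t ^ k * sin (ln t),
      - (INR (S k) * t ^ k * sin (ln t) + t ^ k * cos (ln t)))%R : C)
    by (rewrite tpow_coord; apply injective_projections;
        cbn [fst snd Cmult Cminus Cplus Copp RtoC Ci]; ring).
  apply has_derivative_pair; auto_derive; try exact (conj Ht I); try exact Ht;
    change (match k with O => 1%R | S _ => (INR k + 1)%R end) with (INR (S k));
    cbn [pred pow]; field; lra.
Qed.

(** * Logarithmic spirals *)

(** A reparametrisation [u] of the angle that is onto the real line makes the
    curve run through the whole spiral. *)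
Lemma log_spiral_trace (I : R -> Prop) (z : R -> C) (c : C) (b : R) (u : R -> R) :
  c <> RtoC 0 -> b <> 0%R ->
  (forall t, I t -> z t = c * Cexp ((RtoC b + Ci) * RtoC (u t))) ->
  (forall theta, exists t, I t /\ u t = theta) ->
  traces_log_spiral I z.
Proof.
  intros Hc Hb Hz Hu; exists c, b; split; [exact Hc | split; [exact Hb |]].
  intros w; split.
  - intros [t [It E]]; exists (u t); rewrite <- E; apply Hz, It.
  - intros [theta E]; destruct (Hu theta) as [t [It Et]].
    exists t; split; [exact It |].
    rewrite E, <- Et; apply Hz, It.
Qed.

Lemma pow_S_lt (x y : R) (k : nat) :
  (0 < x < y)%R -> (x ^ S k < y ^ S k)%R.
Proof.
  intros [Hx Hxy]; induction k as [| k IH].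
  - rewrite !pow_1; exact Hxy.
  - apply (Rmult_le_0_lt_compat x y (x ^ S k) (y ^ S k));
      [lra | left; apply pow_lt, Hx | exact Hxy | exact IH].
Qed.

(** The angle is [- ln t], because [t^(k-i) = e^((-k+i) (- ln t))]. *)
Lemma outward_tpow (z : R -> C) (c : C) (k : nat) :
  c <> RtoC 0 -> (forall t, z t = c * tpow (S k) t) ->
  outward_log_spiral (fun t => (0 < t)%R) z.
Proof.
  intros Hc Hz; split.
  - apply (log_spiral_trace _ _ c (- INR (S k)) (fun t => - ln t)%R Hc).
    + apply Ropp_neq_0_compat, not_0_INR; discriminate.
    + intros t Ht; rewrite Hz, tpow_Cexp by exact Ht; do 2 f_equal.
      rewrite !RtoC_opp; ring.
    + intros theta; exists (exp (- theta)); split; [apply exp_pos |].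
      rewrite ln_exp; ring.
  - intros s t Hs Ht Hst; rewrite !Hz, !Cmod_mult, !Cmod_tpow by assumption.
    apply Rmult_lt_compat_l; [apply Cmod_gt_0, Hc |].
    apply pow_S_lt; lra.
Qed.

(** Conjugation reverses the sense of rotation: the angle is now [ln (T-t)]. *)
Lemma inward_tpow (z : R -> C) (T : R) (c : C) (k : nat) :
  c <> RtoC 0 -> (forall t, z t = c * Cconj (tpow (S k) (T - t))) ->
  inward_log_spiral (fun t => (t < T)%R) z.
Proof.
  intros Hc Hz; split.
  - apply (log_spiral_trace _ _ c (INR (S k)) (fun t => ln (T - t)) Hc).
    + apply not_0_INR; discriminate.
    + intros t Ht; rewrite Hz, tpow_Cexp, Cexp_conj by lra; do 2 f_equal.
      apply injective_projections; cbn -[INR]; ring.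
    + intros theta; exists (T - exp theta)%R.
      generalize (exp_pos theta); split; [lra |].
      replace (T - (T - exp theta))%R with (exp theta) by ring.
      apply ln_exp.
  - intros s t Hs Ht Hst; rewrite !Hz, !Cmod_mult, !Cmod_conj, !Cmod_tpow by lra.
    apply Rmult_lt_compat_l; [apply Cmod_gt_0, Hc |].
    apply pow_S_lt; lra.
Qed.

Lemma inward_tpow_lim (z : R -> C) (T : R) (c : C) (k : nat) :
  (forall t, z t = c * Cconj (tpow (S k) (T - t))) ->
  filterlim z (at_left T) (locally (RtoC 0)).
Proof.
  intros Hz.
  apply (filterlim_norm_zero (V := C_R_NormedModule) z).
  apply filterlim_ext_loc with (fun t => Cmod c * (T - t) ^ S k)%R.
  - exists (mkposreal 1 Rlt_0_1); intros t _ Ht.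
    rewrite norm_C_R, Hz, Cmod_mult, Cmod_conj, Cmod_tpow by lra; reflexivity.
  - assert (L : continuous (fun t => Cmod c * (T - t) ^ S k)%R T)
      by (apply (ex_derive_continuous (fun t => Cmod c * (T - t) ^ S k)%R T);
          auto_derive; exact I).
    unfold continuous in L.
    replace (Cmod c * (T - T) ^ S k)%R with 0%R in L by (simpl; ring).
    apply (@filterlim_filter_le_1 _ _ (locally T)); [| exact L].
    apply filter_le_within.
Qed.

(** * Rotation *)

(** Gives that distinct elements of [2 pi Z] are at least [2 pi] apart. *)
Lemma cos_eq_1_0 (x : R) : (Rabs x < 2 * PI)%R -> cos x = 1%R -> x = 0%R.
Proof.
  intros Hx Hc; apply Rabs_def2 in Hx.
  assert (Hs : sin (x / 2) = 0%R).
  { replace x with (2 * (x / 2))%R in Hc by field.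
    rewrite cos_2a_sin in Hc; apply Rsqr_0_uniq; unfold Rsqr; lra. }
  destruct (Rtotal_order x 0) as [H | [H | H]]; [| exact H |].
  - assert (0 < sin (- (x / 2)))%R by (apply sin_gt_0; lra).
    rewrite sin_neg in H0; lra.
  - assert (0 < sin (x / 2))%R by (apply sin_gt_0; lra); lra.
Qed.

(** The difference of two arguments is a continuous function with values in the
    discrete set [2 pi Z]. It is therefore locally constant, so its derivative
    vanishes on the interval and it is constant there. *)
Lemma continuous_argument_unique (a b : R) (f : R -> C) (th1 th2 : R -> R) :
  (forall t, (a < t < b)%R -> f t <> RtoC 0) ->
  continuous_argument (fun t => (a < t < b)%R) f th1 ->
  continuous_argument (fun t => (a < t < b)%R) f th2 ->
  forall s t, (a < s < b)%R -> (a < t < b)%R ->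
    (th1 s - th2 s = th1 t - th2 t)%R.
Proof.
  intros Hf H1 H2.
  set (g := fun t => (th1 t - th2 t)%R).
  assert (Hg : forall t, (a < t < b)%R -> cos (g t) = 1%R /\ sin (g t) = 0%R).
  { intros t Ht; destruct (H1 t Ht) as [_ E1], (H2 t Ht) as [_ E2].
    assert (E : Cexp (Ci * RtoC (th1 t)) = Cexp (Ci * RtoC (th2 t))).
    { assert (N : RtoC (Cmod (f t)) <> 0).
      { intros H; apply RtoC_inj in H; apply (Hf t Ht), Cmod_eq_0, H. }
      rewrite E1 in E2 at 1.
      apply (f_equal (fun z => / RtoC (Cmod (f t)) * z)) in E2.
      rewrite !Cmult_assoc, Cinv_l, !Cmult_1_l in E2 by exact N; exact E2. }
    unfold Cexp in E.
    assert (Ei : forall x : R, Ci * RtoC x = ((0, x)%R : C))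
      by (intros x; apply injective_projections; simpl; ring).
    rewrite !Ei in E; simpl in E; rewrite exp_0 in E.
    injection E; intros Es Ec.
    unfold g; rewrite cos_minus, sin_minus.
    generalize (sin2_cos2 (th2 t)); unfold Rsqr; intros Hsc.
    assert (cos (th1 t) = cos (th2 t)) as -> by lra.
    assert (sin (th1 t) = sin (th2 t)) as -> by lra.
    split; lra. }
  assert (Hd : forall t, (a < t < b)%R -> is_derive g t 0%R).
  { intros t Ht.
    (* [g] takes values in 2 pi Z, so it is constant as long as it varies by
       less than 2 pi. *)
    apply is_derive_ext_loc with (fun _ => g t).
    2: { apply (is_derive_const (V := R_NormedModule)). }
    assert (C : continuous g t)
      by (apply (continuous_minus th1 th2); [apply H1, Ht | apply H2, Ht]).
    assert (P : (0 < 2 * PI)%R) by (generalize PI_RGT_0; lra).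
    assert (L := proj1 (filterlim_locally g (g t)) C (mkposreal _ P)).
    generalize (filter_and _ _ L
      (locally_interval (fun s => (a < s < b)%R) t a b (proj1 Ht) (proj2 Ht)
        (fun s Ha Hb => conj Ha Hb))).
    apply filter_imp; intros s [Hs Hab].
    change (Rabs (g s - g t) < 2 * PI)%R in Hs.
    apply cos_eq_1_0 in Hs; [lra |].
    destruct (Hg s Hab) as [Cs Ss], (Hg t Ht) as [Ct St].
    rewrite cos_minus, Cs, Ss, Ct, St; ring. }
  assert (K : forall s t, (a < s < b)%R -> (a < t < b)%R -> (s < t)%R ->
    g s = g t).
  { intros s t Hs Ht Hst; apply (eq_is_derive (V := R_NormedModule));
      [| exact Hst].
    intros r Hr; apply Hd; lra. }
  intros s t Hs Ht; change (g s = g t).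
  destruct (Rtotal_order s t) as [H | [-> | H]];
    [auto | reflexivity | symmetry; auto].
Qed.

(** By uniqueness, an argument of [f] is [ln (T-t) + c] near [T], and this tends
    to minus infinity. *)
Lemma ln_rotations (f : R -> C) (T r : R) :
  (0 < r)%R ->
  (forall t, (t < T)%R -> f t = RtoC r * Cexp (Ci * RtoC (ln (T - t)))) ->
  infinitely_many_rotations f T.
Proof.
  intros Hr Hf t0 theta Ht0 Hth M delta Hdelta.
  assert (Hm : forall t, (t < T)%R -> Cmod (f t) = r).
  { intros t Ht; rewrite Hf by exact Ht.
    rewrite Cmod_mult, Cmod_Cexp, Cmod_R, Rabs_pos_eq by lra.
    replace (Re (Ci * RtoC (ln (T - t)))) with 0%R by (simpl; ring).
    rewrite exp_0; ring. }
  assert (U := continuous_argument_unique t0 T f theta (fun t => ln (T - t))).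
  cbv beta in U.
  set (m := ((t0 + T) / 2)%R).
  set (c := (theta m - ln (T - m))%R).
  assert (E : forall t, (t0 < t < T)%R -> (theta t = ln (T - t) + c)%R).
  { intros t Ht; unfold c.
    rewrite <- U with (s := t);
      [ring | | exact Hth | | exact Ht | unfold m; lra].
    - intros s Hs; apply Cmod_gt_0; rewrite Hm; lra.
    - intros s Hs; split.
      + apply (ex_derive_continuous (fun t => ln (T - t)) s).
        auto_derive; lra.
      + rewrite Hm by lra; apply Hf; lra. }
  set (B := (Rabs M + Rabs c + 1)%R).
  (* At [t = T - e], [e <= exp (- B)] makes the argument less than [- |M|]; the
     two other bounds keep [t] in the interval and within [delta] of [T]. *)
  set (e := Rmin (exp (- B)) (Rmin ((T - t0) / 2) (delta / 2))).
  assert (He : (0 < e)%R)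
    by (repeat apply Rmin_pos; [apply exp_pos | lra | lra]).
  assert (He1 : (e <= exp (- B))%R) by apply Rmin_l.
  assert (He2 : (e <= Rmin ((T - t0) / 2) (delta / 2))%R) by apply Rmin_r.
  assert (He3 := Rmin_l ((T - t0) / 2) (delta / 2)).
  assert (He4 := Rmin_r ((T - t0) / 2) (delta / 2)).
  exists (T - e)%R; split; [lra | split; [lra |]].
  rewrite E by lra; replace (T - (T - e))%R with e by ring.
  assert (Hl : (ln e <= - B)%R)
    by (rewrite <- (ln_exp (- B)); apply ln_le; assumption).
  unfold B in Hl.
  assert (H1 := Rle_abs M); assert (H2 := Rle_abs c).
  assert (H3 := Rabs_pos M).
  rewrite Rabs_left; lra.
Qed.

(** * The spiral solutions *)

Lemma C_neq_0_re (c : C) : fst c <> 0%R -> c <> RtoC 0.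
Proof. intros H E; apply H; rewrite E; reflexivity. Qed.

Lemma star_solution : is_solution (fun t => (0 < t)%R) z3star z2star z1star.
Proof.
  intros t Ht; split; [| split; [| split]].
  - apply Cmult_neq_0; [apply C_neq_0_re; simpl; lra | apply tpow_neq_0, Ht].
  - replace (z2star t)
      with (RtoC (1 / 10)%R * (RtoC (INR 3) - Ci) * tpow 2 t)
      by (unfold z2star; f_equal; apply injective_projections; simpl; field).
    apply has_derivative_tpow, Ht.
  - replace (z1star t)
      with ((RtoC 3 - Ci) / RtoC 10 * (RtoC (INR 2) - Ci) * tpow 1 t)
      by (unfold z1star; f_equal; apply injective_projections; simpl; field).
    apply has_derivative_tpow, Ht.
  - rewrite (direction_scal_tpow (1 / 10) 3 t) by (lra || reflexivity).
    (* [(3-i)(2-i)(1-i) = -10i] *)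
    replace (- Ci) with
      ((RtoC 2 - Ci) * (RtoC 3 - Ci) / RtoC 10 * (RtoC (INR 1) - Ci))
      by (apply injective_projections; simpl; field).
    apply has_derivative_tpow, Ht.
Qed.

(** Each time derivative changes sign under [t -> T-t]. The sign in front of
    [conj z2] absorbs this in the first two equations; in the third one it is
    absorbed by [conj (-i) = i]. *)
Lemma solution_reverse (T : R) (z3 z2 z1 : R -> C) :
  is_solution (fun t => (0 < t)%R) z3 z2 z1 ->
  is_solution (fun t => (t < T)%R) (fun t => Cconj (z3 (T - t)%R))
    (fun t => - Cconj (z2 (T - t)%R)) (fun t => Cconj (z1 (T - t)%R)).
Proof.
  intros S t Ht.
  destruct (S (T - t)%R) as [N [D3 [D2 D1]]]; [lra |].
  assert (D : forall f l, has_derivative f (T - t) l ->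
    has_derivative (fun s => Cconj (f (T - s)%R)) t (- Cconj l)).
  { intros f l Hf; rewrite <- Copp_conj.
    apply (has_derivative_linear Cconj); [apply is_linear_Cconj |].
    apply has_derivative_reverse, Hf. }
  split; [| split; [| split]].
  - intros E; apply N; rewrite <- (Cconj_conj (z3 _)), E.
    apply injective_projections; simpl; ring.
  - apply D, D3.
  - replace (Cconj (z1 (T - t)%R)) with (-(1) * - Cconj (z1 (T - t)%R)) by ring.
    unfold has_derivative; apply is_derive_ext with
      (fun s => -(1) * Cconj (z2 (T - s)%R)).
    { intros s; change (-(1) * Cconj (z2 (T - s)%R) = - Cconj (z2 (T - s)%R)).
      ring. }
    apply (has_derivative_linear (fun z => -(1) * z));
      [apply is_linear_Cmult | apply D, D2].
  - rewrite (direction_conj z3 _ t (T - t)%R N) by reflexivity.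
    replace (- Ci * Cconj (direction z3 (T - t)))
      with (- Cconj (- Ci * direction z3 (T - t)))
      by (apply injective_projections; simpl; ring).
    apply D, D1.
Qed.

Lemma z3in_eq (T t : R) :
  z3in T t = RtoC (1 / 10)%R * Cconj (tpow 3 (T - t)).
Proof.
  unfold z3in, z3star; rewrite Cmult_conj; f_equal.
  apply injective_projections; simpl; ring.
Qed.

Lemma z2in_eq (T t : R) :
  z2in T t = - Cconj ((RtoC 3 - Ci) / RtoC 10) * Cconj (tpow 2 (T - t)).
Proof. unfold z2in, z2star; rewrite Cmult_conj; ring. Qed.

Lemma z1in_eq (T t : R) :
  z1in T t =
    Cconj ((RtoC 2 - Ci) * (RtoC 3 - Ci) / RtoC 10) * Cconj (tpow 1 (T - t)).
Proof. apply Cmult_conj. Qed.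

Lemma direction_z3in (T t : R) : (t < T)%R ->
  direction (z3in T) t = Cexp (Ci * RtoC (ln (T - t))).
Proof.
  intros Ht.
  rewrite (direction_conj z3star _ t (T - t)%R).
  - rewrite (direction_scal_tpow (1 / 10) 3) by (lra || reflexivity).
    rewrite tpow_Cexp, Cexp_conj by lra; f_equal.
    apply injective_projections; simpl; ring.
  - apply (star_solution (T - t)%R); lra.
  - reflexivity.
Qed.

Lemma Hc_star (t : R) : (0 < t)%R ->
  Hc (z3star t) (z2star t) (z1star t) = RtoC 0.
Proof.
  intros Ht; unfold Hc, z3star at 1.
  rewrite Cmod_mult, Cmod_R, Cmod_tpow, Rabs_pos_eq by lra.
  unfold z2star, z1star; rewrite !tpow_coord.
  generalize (sin2_cos2 (ln t)); unfold Rsqr; intros H.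
  assert (Hs : (sin (ln t) ^ 2 = 1 - cos (ln t) ^ 2)%R) by lra.
  apply injective_projections; simpl; field [Hs].
Qed.

Lemma Ac_star (t : R) : (0 < t)%R ->
  Ac (z3star t) (z2star t) (z1star t) = RtoC 0.
Proof.
  intros Ht; unfold Ac; rewrite Cmod2_conj.
  unfold z3star, z2star, z1star; rewrite !tpow_coord.
  apply injective_projections; simpl; field.
Qed.

Theorem mainTheorem6 (beta1 : R) (beta1_pos : (0 < beta1)%R) :
  (is_solution (fun t => (0 < t)%R) z3star z2star z1star /\
   outward_log_spiral (fun t => (0 < t)%R) z3star /\
   outward_log_spiral (fun t => (0 < t)%R) z2star /\
   outward_log_spiral (fun t => (0 < t)%R) z1star) /\
  (forall T : R, (0 < T)%R ->
    is_solution (fun t => (t < T)%R) (z3in T) (z2in T) (z1in T) /\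
    inward_log_spiral (fun t => (t < T)%R) (z3in T) /\
    inward_log_spiral (fun t => (t < T)%R) (z2in T) /\
    inward_log_spiral (fun t => (t < T)%R) (z1in T) /\
    filterlim (z3in T) (at_left T) (locally (RtoC 0)) /\
    filterlim (z2in T) (at_left T) (locally (RtoC 0)) /\
    filterlim (z1in T) (at_left T) (locally (RtoC 0))) /\
  (forall t : R, (0 < t)%R ->
    Hc (z3star t) (z2star t) (z1star t) = RtoC 0 /\
    Ac (z3star t) (z2star t) (z1star t) = RtoC 0) /\
  (forall T : R, (0 < T)%R ->
    (forall t : R, (t < T)%R -> Cmod (control beta1 (z3in T) t) = beta1) /\
    infinitely_many_rotations (control beta1 (z3in T)) T /\
    infinitely_many_rotations (direction (z3in T)) T).
Proof.
  assert (N3 : RtoC (1 / 10)%R <> 0) by (apply C_neq_0_re; simpl; lra).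
  assert (N2 : (RtoC 3 - Ci) / RtoC 10 <> 0)
    by (apply C_neq_0_re; simpl; lra).
  assert (N1 : (RtoC 2 - Ci) * (RtoC 3 - Ci) / RtoC 10 <> 0)
    by (apply C_neq_0_re; simpl; lra).
  assert (N2' : - Cconj ((RtoC 3 - Ci) / RtoC 10) <> 0)
    by (apply C_neq_0_re; simpl; lra).
  assert (N1' : Cconj ((RtoC 2 - Ci) * (RtoC 3 - Ci) / RtoC 10) <> 0)
    by (apply C_neq_0_re; simpl; lra).
  split; [| split; [| split]].
  - split; [exact star_solution | split; [| split]].
    + apply (outward_tpow _ _ 2 N3); reflexivity.
    + apply (outward_tpow _ _ 1 N2); reflexivity.
    + apply (outward_tpow _ _ 0 N1); reflexivity.
  - intros T _; split; [| split; [| split; [| split; [| split; [| split]]]]].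
    + apply solution_reverse, star_solution.
    + apply (inward_tpow _ T _ 2 N3), z3in_eq.
    + apply (inward_tpow _ T _ 1 N2'), z2in_eq.
    + apply (inward_tpow _ T _ 0 N1'), z1in_eq.
    + apply (inward_tpow_lim _ T _ 2 (z3in_eq T)).
    + apply (inward_tpow_lim _ T _ 1 (z2in_eq T)).
    + apply (inward_tpow_lim _ T _ 0 (z1in_eq T)).
  - intros t Ht; split; [apply Hc_star | apply Ac_star]; exact Ht.
  - intros T _.
    assert (D : forall t, (t < T)%R -> control beta1 (z3in T) t =
        RtoC beta1 * Cexp (Ci * RtoC (ln (T - t)))).
    { intros t Ht; rewrite <- direction_z3in by exact Ht.
      unfold control, direction, Cdiv; ring. }
    split; [| split].
    + intros t Ht; rewrite D by exact Ht.
      rewrite Cmod_mult, Cmod_Cexp, Cmod_R, Rabs_pos_eq by lra.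
      replace (Re (Ci * RtoC (ln (T - t)))) with 0%R by (simpl; ring).
      rewrite exp_0; ring.
    + exact (ln_rotations _ T beta1 beta1_pos D).
    + apply (ln_rotations _ T 1 Rlt_0_1).
      intros t Ht; rewrite direction_z3in by exact Ht; ring.
Qed.
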